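(* Let $G$, $\Theta$, $\mathcal H$, $g\mapsto U_g$, $\{\rho_\theta\}$, the orbit-averaged experiment $\overline{\mathcal Q}=\{\bar\rho_\eta:\eta\in\Theta/G\}$, the invariant algebra $\mathcal A_G$, and the finite block decomposition $\mathcal H=\bigoplus_{z\in\mathsf Z}\mathcal H_z$ with projections $\Pi_z$ central in $\mathcal A_G$ be as described in the context, and put $p_\eta(z):=\operatorname{Tr}(\bar\rho_\eta\Pi_z)$. Suppose that $$\bar\rho_\eta=\bigoplus_{z\in\mathsf Z}p_\eta(z)\,\tau_z\qquad\text{for every }\eta\in\Theta/G,$$ where each $\tau_z$ is a density operator on $\mathcal H_z$ that does not depend on $\eta$. Then the block-label measurement $M^\star(\{z\})=\Pi_z$, $z\in\mathsf Z$, is quantum-to-classically sufficient for $\overline{\mathcal Q}$ relative to the class of all $G$-invariant POVMs on $\mathcal H$.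
   Context: **Symmetric model.** $G$ is a compact Hausdorff group with normalized Haar measure $dg$, acting measurably on a parameter space $\Theta$; $g\mapsto U_g$ is a strongly continuous unitary representation of $G$ on a separable complex Hilbert space $\mathcal H$; $\{\rho_\theta:\theta\in\Theta\}$ is a family of density operators on $\mathcal H$ with $\rho_{g\theta}=U_g\rho_\theta U_g^\dagger$ for all $g,\theta$. $\Theta/G$ is the orbit space and $\pi:\Theta\to\Theta/G$ the quotient map. The orbit-averaged state is $\bar\rho_\eta:=\int_G U_g\rho_\theta U_g^\dagger\,dg$ (trace-norm Bochner integral) for any $\theta$ with $\pi(\theta)=\eta$; it does not depend on the choice of $\theta$. **Blocks.** $\mathcal A_G:=\{A\in\mathcal L(\mathcal H):[A,U_g]=0\ \forall g\in G\}$, where $\mathcal L(\mathcal H)$ denotes the bounded operators. $\mathsf Z$ is a finite set and $\mathcal H=\bigoplus_{z\in\mathsf Z}\mathcal H_z$ is an orthogonal decomposition into nonzero subspaces whose orthogonal projections $\Pi_z$ are central in $\mathcal A_G$. **POVMs and sufficiency.** A POVM $M$ on $\mathcal H$ with outcome space $(\mathsf Y,\mathcal Y)$ is a map from $\mathcal Y$ to positive bounded operators that is countably additive in the weak operator topology, with $M(\mathsf Y)=I$; outcome spaces are standard Borel. $M$ is $G$-invariant if $U_g^\dagger M(B)U_g=M(B)$ for all $g$ and $B$. For a family of states $\mathcal Q=\{\sigma_\eta\}$, put $P^M_\eta(B):=\operatorname{Tr}[\sigma_\eta M(B)]$. A measurement $M^\star$ in a class $\mathfrak M$ of POVMs is *quantum-to-classically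 sufficient* for $\mathcal Q$ relative to $\mathfrak M$ if for every $N\in\mathfrak M$ there is a Markov kernel $K_N$ (not depending on $\eta$) from the outcome space of $M^\star$ to that of $N$ with $P^N_\eta(B)=\int K_N(x,B)\,P^{M^\star}_\eta(dx)$ for all $\eta$ and all measurable $B$. *)

(* Defs.v *)
From HB Require Import structures.
From mathcomp Require Import all_boot all_order all_algebra.
From mathcomp Require Import complex.
From mathcomp Require Import all_classical all_reals all_analysis.

Set Implicit Arguments.
Unset Strict Implicit.
Unset Printing Implicit Defensive.

Import Order.TTheory GRing.Theory Num.Theory.
Import numFieldNormedType.Exports.

Local Open Scope classical_set_scope.
Local Open Scope complex_scope.
Local Open Scope ring_scope.

Definition separable (T : topologicalType) :=
  exists2 D : set T, countable D & dense D.

Section operators.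
Context (R : realType) (H : completeNormedModType R[i]).
Variable dot : {dot H for Num.conj}.
Implicit Types (A B P : H -> H) (V : set H).

(* [H] is a complex Hilbert space: its complete norm is the one of [dot].
   Following MathComp, [dot] is linear in its first argument and
   conjugate-linear in the second one. *)
Definition hilbert_norm := forall x : H, `|x| ^+ 2 = dot x x.

Definition bounded_operator A :=
  linear A /\ exists M : R[i], forall x, `|A x| <= M * `|x|.

Definition is_adjoint A B := forall x y, dot (A x) y = dot x (B y).

Definition adjoint A : H -> H := xget (cst 0) [set B | is_adjoint A B].

Definition unitary A :=
  [/\ bounded_operator A, adjoint A \o A = id & A \o adjoint A = id].

(* In the order of [R[i]], [0 <= c] says that [c] is a nonnegative real. *)
Definition positive_operator A :=
  bounded_operator A /\ forall x, 0 <= dot (A x) x.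

(* A countable orthonormal basis. The family is indexed by [nat] whatever the
   dimension of [H] is: unused indices carry the zero vector. *)
Definition orthonormal_basis (e : nat -> H) :=
  [/\ forall i j, i != j -> dot (e i) (e j) = 0,
      forall i, e i = 0 \/ dot (e i) (e i) = 1 &
      forall x, (fun n => \sum_(i < n) dot x (e i) *: e i) @ \oo --> x].

Definition has_trace A (t : R[i]) := forall e, orthonormal_basis e ->
  (fun n => \sum_(i < n) dot (A (e i)) (e i) : R[i]^o) @ \oo --> (t : R[i]^o).

Definition trace A : R[i] := xget 0 [set t | has_trace A t].

Definition density_operator A := positive_operator A /\ trace A = 1.

(* [P] is the modulus |A|, the positive square root of A^* A. *)
Definition is_modulus A P :=
  positive_operator P /\ exists2 B, is_adjoint A B & P \o P = B \o A.

(* Tr |A|, which is [+oo] when [A] is not trace class. *)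
Definition trace_norm A : \bar R :=
  xget +oo%E [set t%:E | t in
    [set t : R | exists2 P, is_modulus A P & has_trace P t%:C]].

Definition trace_class A := bounded_operator A /\ (trace_norm A < +oo)%E.

Definition subspace V := V 0 /\ forall a x y, V x -> V y -> V (a *: x + y).

Definition orthogonal_projection V P :=
  forall x, V (P x) /\ forall y, V y -> dot (x - P x) y = 0.

(* A density operator on the subspace [V], extended by zero to the orthogonal
   complement of [V]. *)
Definition density_operator_on V A :=
  [/\ density_operator A, forall x, V (A x) &
      forall x, (forall y, V y -> dot x y = 0) -> A x = 0].

Definition orthogonal_decomposition (Z : choiceType) (Hz : Z -> set H) :=
  [/\ forall z, subspace (Hz z),
      forall z, exists2 x, Hz z x & x != 0,
      forall z z' x y, z != z' -> Hz z x -> Hz z' y -> dot x y = 0 &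
      forall x, exists2 v : Z -> H,
        forall z, Hz z (v z) & x = \sum_(z \in [set: Z]) v z].

Section bochner.
Context d (T : measurableType d) (mu : {measure set T -> \bar R}).
Implicit Types (s F : T -> H -> H).

Definition simple_operator_function s :=
  [/\ finite_set (range s), forall A, measurable (s @^-1` [set A]) &
      forall t, trace_class (s t)].

Definition simple_integral s : H -> H := fun x =>
  \sum_(A \in range s) (fine (mu (s @^-1` [set A])))%:C *: A x.

Definition is_bochner_integral F A :=
  trace_class A /\
  exists s : nat -> T -> H -> H,
  [/\ forall n, simple_operator_function (s n),
      forall n, mu.-integrable setT (fun t => trace_norm (F t \- s n t)),
      (fun n => \int[mu]_t trace_norm (F t \- s n t)%R)%E @ \oo --> 0%E &
      (fun n => trace_norm (A \- simple_integral (s n))) @ \oo --> 0%E].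

End bochner.

End operators.

HB.mixin Record isTopologicalGroup G of Group G & PointedTopological G := {
  mulg_continuous : continuous (fun xy : G * G => (xy.1 * xy.2)%g);
  invg_continuous : continuous (fun x : G => x^-1%g)
}.

#[short(type="topologicalGroupType")]
HB.structure Definition TopologicalGroup :=
  {G of Group G & PointedTopological G & isTopologicalGroup G}.

Definition borel (G : ptopologicalType) := g_sigma_algebraType (@open G).

(* Inner regularity is part of the definition, since [G] need not be second
   countable; on a compact space it also gives outer regularity. *)
Definition is_haar (R : realType) (G : topologicalGroupType)
    (mu : probability (borel G) R) :=
  (forall (g : G) (B : set (borel G)), measurable B ->
     mu [set (g * h)%g | h in (B : set G)] = mu B) /\
  (forall B : set (borel G), measurable B ->
     mu B = ereal_sup [set mu K | K in
              [set K : set G | compact K /\ K `<=` B]]).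

Definition measurable_action (G : topologicalGroupType) d
    (Theta : measurableType d) (act : G -> Theta -> Theta) :=
  [/\ forall theta, act 1%g theta = theta,
      forall g h theta, act (g * h)%g theta = act g (act h theta) &
      measurable_fun setT (fun p : borel G * Theta => act p.1 p.2)].

Section orbits.
Context (G Theta : Type) (act : G -> Theta -> Theta).

Definition orbit (theta : Theta) : set Theta := range (act^~ theta).

Definition orbit_space := {O : set Theta | exists theta, orbit theta = O}.

Definition orbit_proj (theta : Theta) : orbit_space :=
  exist _ (orbit theta) (ex_intro _ theta erefl).

End orbits.

Section symmetric_model.
Context (R : realType) (H : completeNormedModType R[i]).
Variable dot : {dot H for Num.conj}.
Context (G : topologicalGroupType) (U : G -> H -> H).

Definition unitary_representation :=
  [/\ forall g, unitary dot (U g),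
      U 1%g = id,
      forall g h, U (g * h)%g = U g \o U h &
      forall x, continuous (fun g => U g x)].

Definition covariant Theta (act : G -> Theta -> Theta)
    (rho : Theta -> H -> H) :=
  forall g theta, rho (act g theta) = U g \o rho theta \o adjoint dot (U g).

(* The common value, over all [theta] in the orbit [eta], of the Bochner
   integrals of [U g \o rho theta \o (U g)^*]. *)
Definition orbit_averaged_state (mu : probability (borel G) R) Theta
    (act : G -> Theta -> Theta) (rho : Theta -> H -> H)
    (eta : orbit_space act) : H -> H :=
  xget (cst 0) [set A | forall theta, orbit_proj act theta = eta ->
    is_bochner_integral dot mu
      (fun g : borel G => U g \o rho theta \o adjoint dot (U g)) A].

Definition invariant_algebra : set (H -> H) :=
  [set A | bounded_operator A /\ forall g, A \o U g = U g \o A].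

Definition central (S : set (H -> H)) (P : H -> H) :=
  S P /\ forall A, S A -> P \o A = A \o P.

Definition standard_borel d (Y : measurableType d) :=
  exists (T : completePseudoMetricType R) (f : Y -> T),
  [/\ hausdorff_space T, separable T, bijective f &
      forall B : set Y, measurable B <-> <<s @open T >> (f @` B)].

Definition povm d (Y : measurableType d) (M : set Y -> H -> H) :=
  [/\ standard_borel Y,
      forall B, measurable B -> positive_operator dot (M B),
      forall F : (set Y)^nat, (forall n, measurable (F n)) ->
        trivIset setT F -> forall x y,
        (fun n => \sum_(k < n) dot (M (F k) x) y : R[i]^o) @ \oo -->
          (dot (M (\bigcup_n F n) x) y : R[i]^o) &
      M setT = id].

Definition invariant_povm d (Y : measurableType d) (M : set Y -> H -> H) :=
  povm M /\ forall g B, measurable B -> adjoint dot (U g) \o M B \o U g = M B.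

(* For a state and a POVM the trace is a nonnegative real number, so nothing is
   lost by taking its real part. *)
Definition outcome_law d (Y : measurableType d) (sigma : H -> H)
    (M : set Y -> H -> H) (B : set Y) : \bar R :=
  (complex.Re (trace dot (sigma \o M B)))%:E.

Definition qc_sufficient E (Q : E -> H -> H)
    (class : forall d (Y : measurableType d), (set Y -> H -> H) -> Prop)
    d (X : measurableType d) (M : set X -> H -> H) :=
  class d X M /\
  forall d' (Y : measurableType d') (N : set Y -> H -> H), class d' Y N ->
    exists K : R.-pker X ~> Y, forall eta B, measurable B ->
      outcome_law (Q eta) N B = (\int[outcome_law (Q eta) M]_x K x B)%E.

(* The measurement with [M {z} = Pi z]. *)
Definition block_label (Z : choiceType) (Pi : Z -> H -> H) (B : set Z) : H -> H :=
  fun x => \sum_(z \in B) Pi z x.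

End symmetric_model.

Arguments orbit_averaged_state {R H} dot {G} U mu {Theta} act rho eta _.

(* Main.v *)
(* With [K z B = Tr (tau z N B)] one has, for a block-diagonal state,
   [Tr (rhobar eta N B) = \sum_z p eta z * K z B], and [p eta z] is the
   probability of the label [z]: this is the required factorization through the
   label. That [K z] is a probability measure, and that the traces exist and do
   not depend on the basis, follows from writing [tau z] as a sum of rank-one
   operators [x |-> <x, v_k> v_k], obtained by a Cholesky decomposition along a
   dense sequence: then [Tr (tau z N B) = \sum_k <N B v_k, v_k>], a series of
   measures of total mass [\sum_k |v_k|^2 = 1]. The weights [p eta z] are
   nonnegative because a Bochner integral of positive operators is positive. *)
From HB Require Import structures.
Require Import Defs.
From mathcomp Require Import all_boot all_order all_algebra.
From mathcomp Require Import complex ring lra finmap.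
From mathcomp Require Import all_classical all_reals all_analysis measurable_realfun.
Import Order.TTheory GRing.Theory Num.Theory.
Import numFieldNormedType.Exports.
Local Open Scope classical_set_scope.
Local Open Scope complex_scope.
Local Open Scope ring_scope.

Set Implicit Arguments.
Unset Strict Implicit.
Unset Printing Implicit Defensive.

Local Notation Re := complex.Re.
Local Notation Im := complex.Im.

(** [trace] is 0 by default when no number is the trace in every orthonormal basis, so traces are
    obtained as [has_trace] statements: convergence of ordered partial sums in an arbitrary basis,
    to a limit free of the basis. For [tau z \o N B] this is the main obstacle: a product of
    positive operators need not be positive, its diagonal terms have no sign, and Tonelli does not
    directly exchange the sums over the basis and over [k]. Polarization turns the real and the
    imaginary part into differences of nonnegative double series, which are finite because
    [\sum_k |v_k|^2] converges and [N B] is bounded. From the Bochner integral only the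
    nonnegativity of the quadratic form is extracted. The sign of [p eta z] then comes from testing
    this form on a vector of the block [z]. *)

Lemma eq_cvgn (T : topologicalType) (f g : nat -> T) (l : T) :
  f @ \oo --> l -> f =1 g -> g @ \oo --> l.
Proof. by move=> fl /funext <-. Qed.

Lemma cvgn_sum (K : numFieldType) (V : normedModType K) I (s : seq I)
    (f : I -> nat -> V) (l : I -> V) :
  (forall i, f i @ \oo --> l i) ->
  (fun n => \sum_(i <- s) f i n) @ \oo --> \sum_(i <- s) l i.
Proof.
move=> fl; elim: s => [|i s IH].
  by rewrite big_nil; apply: (eq_cvgn (cvg_cst (0 : V))) => n; rewrite big_nil.
by rewrite big_cons; apply: (eq_cvgn (cvgD (fl i) IH)) => n; rewrite big_cons.
Qed.

(** * Complex limits by real and imaginary parts *)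

Section complex_limits.
Context {R : realType}.
Implicit Types (z w : R[i]) (u : nat -> R[i]).

Lemma ReD z w : Re (z + w) = Re z + Re w.
Proof. by case: z w => a b [c e]. Qed.

Lemma ImD z w : Im (z + w) = Im z + Im w.
Proof. by case: z w => a b [c e]. Qed.

Lemma ReB z w : Re (z - w) = Re z - Re w.
Proof. by case: z w => a b [c e]. Qed.

Lemma ImB z w : Im (z - w) = Im z - Im w.
Proof. by case: z w => a b [c e]. Qed.

Lemma Re_sum I (s : seq I) (P : pred I) (F : I -> R[i]) :
  Re (\sum_(i <- s | P i) F i) = \sum_(i <- s | P i) Re (F i).
Proof. by apply: (big_morph (@complex.Re R) ReD). Qed.

Lemma Im_sum I (s : seq I) (P : pred I) (F : I -> R[i]) :
  Im (\sum_(i <- s | P i) F i) = \sum_(i <- s | P i) Im (F i).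
Proof. by apply: (big_morph (@complex.Im R) ImD). Qed.

Lemma ge0_ReE z : 0 <= z -> z = (Re z)%:C.
Proof. by case: z => a b; rewrite lecE /= => /andP[/eqP-> _]. Qed.

Lemma norm_Re_le z : (`|Re z|)%:C <= `|z|.
Proof.
rewrite normc_def lecR -(ler_pXn2r (_ : 0 < 2)%N)// ?nnegrE ?sqrtr_ge0//.
by rewrite sqr_sqrtr ?addr_ge0 ?sqr_ge0// real_normK ?num_real// lerDl sqr_ge0.
Qed.

Lemma norm_Im_le z : (`|Im z|)%:C <= `|z|.
Proof.
rewrite normc_def lecR -(ler_pXn2r (_ : 0 < 2)%N)// ?nnegrE ?sqrtr_ge0//.
by rewrite sqr_sqrtr ?addr_ge0 ?sqr_ge0// real_normK ?num_real// lerDr sqr_ge0.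
Qed.

Lemma norm_le_ReIm z : `|z| <= (`|Re z| + `|Im z|)%:C.
Proof.
rewrite normc_def lecR -(ler_pXn2r (_ : 0 < 2)%N) ?nnegrE ?sqrtr_ge0 ?addr_ge0//.
rewrite sqr_sqrtr ?addr_ge0 ?sqr_ge0// sqrrD !real_normK ?num_real//.
by rewrite addrAC lerDl mulrn_wge0 ?mulr_ge0.
Qed.

Lemma cvg_complexP u z :
  ((fun n => u n : R[i]^o) @ \oo --> (z : R[i]^o)) <->
  ((fun n => Re (u n)) @ \oo --> Re z) /\ ((fun n => Im (u n)) @ \oo --> Im z).
Proof.
split=> [uz|[rz iz]].
- have close (e : R) : 0 < e -> \forall n \near \oo, `|z - u n| < e%:C.
    move=> e0; have/cvgrPdist_lt/(_ e%:C) := uz.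
    by rewrite ltcR; apply.
  split; apply/cvgrPdist_lt => e /close; apply: filterS => n; rewrite -ltcR.
  + by apply: le_lt_trans; rewrite -ReB; exact: norm_Re_le.
  + by apply: le_lt_trans; rewrite -ImB; exact: norm_Im_le.
- apply/cvgrPdist_lt => e e0; rewrite (ge0_ReE (ltW e0)).
  have e20 : 0 < Re e / 2 by move: e0; rewrite ltcE => /andP[_ /=]; lra.
  near=> n; apply: (le_lt_trans (norm_le_ReIm _)); rewrite ltcR.
  rewrite [X in _ < X]splitr ltrD//.
  + by rewrite ReB; near: n; move/cvgrPdist_lt: rz; apply.
  + by rewrite ImB; near: n; move/cvgrPdist_lt: iz; apply.
Unshelve. all: by end_near. Qed.

Lemma quad_discriminant (a b c : R) : 0 <= c ->
  (forall t, 0 <= a + 2 * t * b + t ^+ 2 * c) -> b ^+ 2 <= a * c.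
Proof.
rewrite le_eqVlt => /orP[/eqP<-|c0] h.
- rewrite mulr0; have [->|b0] := eqVneq b 0; first by rewrite expr0n.
  (* Since [c = 0] the polynomial is affine in [t], and here it equals [-1]. *)
  have := h (- (a + 1) / (2 * b)); rewrite mulr0 addr0.
  have -> : 2 * (- (a + 1) / (2 * b)) * b = - (a + 1) by field.
  lra.
- have := h (- b / c).
  have -> : a + 2 * (- b / c) * b + (- b / c) ^+ 2 * c = (a * c - b ^+ 2) / c.
    by field; rewrite gt_eqF.
  by rewrite pmulr_lge0 ?invr_gt0// subr_ge0.
Qed.

End complex_limits.

(** * Positive forms, Cauchy-Schwarz inequalities and the Hilbert norm *)

Section real_inner_product.
Context {R : realType} {H : completeNormedModType R[i]}.
Variable dot : {dot H for Num.conj}.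
Implicit Types (x y z : H) (A : H -> H).

(* The real part of [dot] determines it, since
   [Im (dot x y) = Re (dot x ('i *: y))]; most estimates are done with it. *)
Definition rdot x y : R := Re (dot x y).

Lemma dotE x y : dot x y = rdot x y +i* rdot x ('i *: y).
Proof.
rewrite /rdot linearZr_LR /=.
by case: (dot x y) => a b; rewrite /= !mul0r mulN1r opprK add0r.
Qed.

Lemma dot_conj x y : dot x y = (dot y x)^*%C.
Proof. by rewrite hermC expr0 mul1r. Qed.

Lemma rdotC x y : rdot x y = rdot y x.
Proof. by rewrite /rdot dot_conj; case: (dot y x). Qed.

Lemma rdotDl x y z : rdot (x + y) z = rdot x z + rdot y z.
Proof. by rewrite /rdot linearDl ReD. Qed.

Lemma rdotBl x y z : rdot (x - y) z = rdot x z - rdot y z.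
Proof. by rewrite /rdot linearBl ReB. Qed.

Lemma rdotDr x y z : rdot x (y + z) = rdot x y + rdot x z.
Proof. by rewrite rdotC rdotDl !(rdotC x). Qed.

Lemma rdotBr x y z : rdot x (y - z) = rdot x y - rdot x z.
Proof. by rewrite rdotC rdotBl !(rdotC x). Qed.

Lemma rdotZl (c : R) x y : rdot (c%:C *: x) y = c * rdot x y.
Proof.
by rewrite /rdot linearZl_LR/=; case: (dot x y) => a b /=; rewrite mul0r subr0.
Qed.

Lemma rdotZr (c : R) x y : rdot x (c%:C *: y) = c * rdot x y.
Proof. by rewrite rdotC rdotZl rdotC. Qed.

Lemma rdot_suml I (s : seq I) (F : I -> H) y :
  rdot (\sum_(i <- s) F i) y = \sum_(i <- s) rdot (F i) y.
Proof.
by apply: (big_morph (rdot^~ y)) => [a b|]; rewrite ?rdotDl// /rdot linear0l.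
Qed.

Definition nsq x : R := rdot x x.

Lemma dotxx x : dot x x = (nsq x)%:C.
Proof. by apply: ge0_ReE; exact: dnorm_ge0. Qed.

Lemma nsq_ge0 x : 0 <= nsq x.
Proof. by rewrite -ler0c -dotxx dnorm_ge0. Qed.

Lemma nsq_eq0 x : nsq x = 0 -> x = 0.
Proof. by move=> x0; apply/eqP; rewrite -(dnorm_eq0 dot) dotxx x0. Qed.

Lemma nsqD x y : nsq (x + y) = nsq x + 2 * rdot x y + nsq y.
Proof. by rewrite /nsq rdotDl !rdotDr (rdotC y x); ring. Qed.

Lemma nsqB x y : nsq (x - y) = nsq x - 2 * rdot x y + nsq y.
Proof. by rewrite /nsq rdotBl !rdotBr (rdotC y x); ring. Qed.

Lemma linear_comb A : linear A ->
  [/\ forall x y, A (x + y) = A x + A y, forall x y, A (x - y) = A x - A y,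
      forall a x, A (a *: x) = a *: A x & A 0 = 0].
Proof.
move=> lA.
have A0 : A 0 = 0.
  by have /esym := lA 1 0 0; rewrite !scale1r addr0 -[RHS]addr0 => /addrI.
have AZ a x : A (a *: x) = a *: A x by have := lA a x 0; rewrite A0 !addr0.
have AD x y : A (x + y) = A x + A y by have := lA 1 x y; rewrite !scale1r.
by split => // x y; rewrite AD -scaleN1r AZ scaleN1r.
Qed.

Definition csq (z : R[i]) : R := Re z ^+ 2 + Im z ^+ 2.

Lemma csq_ge0 (z : R[i]) : 0 <= csq z.
Proof. by rewrite addr_ge0 ?sqr_ge0. Qed.

Section positive_forms.
Variable A : H -> H.
Hypotheses (lA : linear A) (A0 : forall x, 0 <= dot (A x) x).

Let AD x y : A (x + y) = A x + A y. Proof. by case: (linear_comb lA). Qed.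
Let AZ a x : A (a *: x) = a *: A x. Proof. by case: (linear_comb lA). Qed.

Lemma positive_rdot_ge0 x : 0 <= rdot (A x) x.
Proof. by rewrite /rdot -ler0c -ge0_ReE. Qed.

(** Over the complex numbers positivity forces symmetry: the form takes real values, and the
    imaginary part of its value at [x + 'i *: y] is, up to sign, the difference of the two sides. *)
Lemma positive_rdotC x y : rdot (A x) y = rdot x (A y).
Proof.
have im0 z : Im (dot (A z) z) = 0 by have := A0 z; rewrite lecE => /andP[/eqP].
have := im0 (x + 'i *: y).
rewrite AD AZ linearDl/= !linearDr/= !linearZl_LR/= !linearZr_LR/= !ImD im0.
have := im0 y; rewrite /rdot (dot_conj x).
case: (dot (A x) y) (dot (A y) x) (dot (A y) y) => a b [c e] [f g] /=; lra.
Qed.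

Lemma positive_dotC x y : dot (A x) y = dot x (A y).
Proof. by rewrite !dotE -AZ !positive_rdotC. Qed.

Lemma positive_CS_re x y :
  rdot (A x) y ^+ 2 <= rdot (A x) x * rdot (A y) y.
Proof.
apply: quad_discriminant => [|t]; first exact: positive_rdot_ge0.
have := positive_rdot_ge0 (x + t%:C *: y).
rewrite AD AZ rdotDl !rdotDr !rdotZl !rdotZr (positive_rdotC y x) (rdotC y).
by congr (_ <= _); ring.
Qed.

Lemma positive_CS x y :
  csq (dot (A x) y) <= rdot (A x) x * rdot (A y) y.
Proof.
set z := dot (A x) y.
have z0 := csq_ge0 z.
(* Multiplying [y] by [z] makes the form at this pair equal to [csq z]. Both sides of the real
   inequality then carry one extra factor [csq z], which cancels unless it is 0. *)
have := positive_CS_re x (z *: y).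
rewrite {1 3}/rdot AZ linearZr_LR/= linearZr_LR/= linearZl_LR/= -/z.
rewrite (ge0_ReE (A0 y)).
have -> : Re (z^* * z) = csq z by rewrite /csq; case: (z) => a b /=; ring.
have -> : Re (z^* * (z * (Re (dot (A y) y))%:C)) = csq z * rdot (A y) y.
  by rewrite /csq /rdot; case: (z) (dot _ _) => a b [c e] /=; ring.
have [->|zN0] := eqVneq (csq z) 0.
  by rewrite mulr_ge0// positive_rdot_ge0.
rewrite expr2 mulrCA ler_pM2l//.
by rewrite lt_neqAle eq_sym zN0.
Qed.

(** Cauchy-Schwarz for the form of [A], tested against [A x] itself, bounds [nsq (A x) ^+ 2] by
    0. *)
Lemma positive_ker x : rdot (A x) x = 0 -> A x = 0.
Proof.
move=> Ax0; apply: nsq_eq0; apply/eqP; rewrite -sqrf_eq0 eq_le sqr_ge0 andbT.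
by have := positive_CS_re x (A x); rewrite Ax0 mul0r.
Qed.

End positive_forms.

Lemma CS x y : csq (dot x y) <= nsq x * nsq y.
Proof. by apply: (@positive_CS id) => // z; exact: dnorm_ge0. Qed.

Lemma CS_re x y : rdot x y ^+ 2 <= nsq x * nsq y.
Proof. by apply: (@positive_CS_re id) => // z; exact: dnorm_ge0. Qed.

Hypothesis normH : hilbert_norm dot.

Lemma normE x : `|x| = (Num.sqrt (nsq x))%:C.
Proof.
apply/eqP; rewrite -(@eqrXn2 _ 2)// ?ler0c ?sqrtr_ge0//.
by rewrite normH dotxx -rmorphXn/= sqr_sqrtr ?nsq_ge0.
Qed.

(** The bound [M] is a complex number, so its squared modulus serves as real constant. For [x != 0]
    the inequality [0 <= M * |x|] forces [M] to be a nonnegative real, hence [M <= |M|]. *)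
Lemma bounded_nsq A : bounded_operator A ->
  exists2 C, 0 <= C & forall x, nsq (A x) <= C * nsq x.
Proof.
move=> [lA [M hM]]; exists (csq M); first exact: csq_ge0.
move=> x; rewrite -lecR rmorphM/= -!dotxx -!normH /csq add_Re2_Im2 -exprMn.
rewrite lerXn2r ?nnegrE ?mulr_ge0//.
have := hM x; have [->|x0] := eqVneq x 0; first by rewrite !normr0 !mulr0.
move=> h; apply: (le_trans h); rewrite ler_wpM2r//.
rewrite real_ler_norm// realE -(pmulr_lge0 _ (_ : 0 < `|x|)) ?normr_gt0//.
by rewrite (le_trans _ h).
Qed.

Lemma cvg_rdotl (u : nat -> H) x y : u @ \oo --> x ->
  (fun n => rdot (u n) y) @ \oo --> rdot x y.
Proof.
move=> ux; apply/cvgrPdist_lt => e e0.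
(* The [+ 1] keeps the denominator positive when [y = 0]. *)
have d0 : 0 < e / Num.sqrt (nsq y + 1).
  by rewrite divr_gt0// sqrtr_gt0 ltr_wpDl// nsq_ge0.
move/cvgrPdist_lt: ux => /(_ (e / Num.sqrt (nsq y + 1))%:C).
rewrite ltcR => /(_ d0).
apply: filterS => n; rewrite normE ltcR ltr_pdivlMr ?sqrtr_gt0 ?ltr_wpDl ?nsq_ge0//.
rewrite -sqrtrM ?nsq_ge0// => h; rewrite -rdotBl; apply: le_lt_trans h.
rewrite -sqrtr_sqr ler_wsqrtr// (le_trans (CS_re _ _))// ler_wpM2l ?nsq_ge0//.
by rewrite lerDl.
Qed.

End real_inner_product.

(** Gives access to series in [\bar R], where nonnegative double series can be exchanged before
    anything is known about their convergence. *)
Lemma nnseries_cvgP (R : realType) (f : nat -> R) (l : R) :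
  (forall k, 0 <= f k) ->
  ((fun n => \sum_(i < n) f i) @ \oo --> l) <->
  (\sum_(k <oo) (f k)%:E = l%:E)%E.
Proof.
move=> f0.
have E : (fun n => \sum_(0 <= k < n) (f k)%:E)%E =
         (fun n => (\sum_(i < n) f i)%:E).
  by apply/funext => n; rewrite sumEFin big_mkord.
split=> [fl|fl].
- by rewrite E; apply/cvg_lim => //; apply: cvg_EFin fl; exact: nearW.
- have: (fun n => \sum_(0 <= k < n) (f k)%:E)%E @ \oo --> l%:E.
    rewrite -fl; apply: is_cvg_nneseries => n _ _.
    by rewrite lee_fin.
  by rewrite E => /fine_cvgP[_].
Qed.

(** * Cholesky decomposition of a positive operator *)

(* Subtracting from a positive [T] the rank-one operator of
   [T w / sqrt <T w, w>] keeps it positive (Cauchy-Schwarz) and puts [w] in its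
   kernel. Doing so along a dense sequence exhausts [T]; for [T = id] the vectors
   produced are an orthonormal basis (Gram-Schmidt). *)
Section cholesky.
Context {R : realType} {H : completeNormedModType R[i]}.
Variable dot : {dot H for Num.conj}.
Implicit Types (x y : H) (T : H -> H).

Local Notation rd := (rdot dot).
Local Notation sq := (nsq dot).

(* It vanishes when [rd (T w) w = 0], because [0^-1 = 0]. *)
Definition pivot_vector T (w : H) : H :=
  ((Num.sqrt (rd (T w) w))^-1)%:C *: T w.

Definition cholesky_step T (w : H) x : H :=
  T x - dot x (pivot_vector T w) *: pivot_vector T w.

Fixpoint cholesky T (w : nat -> H) n : H -> H :=
  if n is n'.+1 then cholesky_step (cholesky T w n') (w n') else T.

Definition cholesky_vector T (w : nat -> H) n : H :=
  pivot_vector (cholesky T w n) (w n).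

Lemma dot_mul_conj x y : dot x y * dot y x = (csq (dot x y))%:C.
Proof.
rewrite (dot_conj dot y); case: (dot x y) => a b.
by rewrite /csq; apply/eqP; rewrite eq_complex /=; apply/andP; split;
  apply/eqP; ring.
Qed.

Section step.
Variables (T : H -> H) (w : H).
Hypotheses (lT : linear T) (T0 : forall x, 0 <= dot (T x) x).

Let TD x y : T (x + y) = T x + T y. Proof. by case: (linear_comb lT). Qed.
Let TB x y : T (x - y) = T x - T y. Proof. by case: (linear_comb lT). Qed.
Let TZ a x : T (a *: x) = a *: T x. Proof. by case: (linear_comb lT). Qed.
Let a := rd (T w) w.
Let v := pivot_vector T w.

Let a_ge0 : 0 <= a. Proof. exact: positive_rdot_ge0. Qed.

Lemma dot_pivot_vector x :
  dot x (pivot_vector T w) = ((Num.sqrt a)^-1)%:C * dot (T x) w.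
Proof.
rewrite /pivot_vector linearZr_LR/= (positive_dotC lT T0); congr (_ * _).
by apply/eqP; rewrite eq_complex /= oppr0 !eqxx.
Qed.

Lemma cholesky_step_linear : linear (cholesky_step T w).
Proof.
move=> c x y; rewrite /cholesky_step lT linearDl/= linearZl_LR/=.
by rewrite scalerBr scalerDl !scalerA opprD addrACA.
Qed.

Lemma dot_cholesky_step x :
  dot (cholesky_step T w x) x = (rd (T x) x - csq (dot x v))%:C.
Proof.
rewrite /cholesky_step linearBl linearZl_LR/= dot_mul_conj rmorphB/=.
by rewrite {1}(ge0_ReE (T0 x)).
Qed.

Lemma csq_dot_pivot_vector x : csq (dot x v) <= rd (T x) x.
Proof.
rewrite /v dot_pivot_vector.
have -> (r : R) (z : R[i]) : csq (r%:C * z) = r ^+ 2 * csq z.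
  by rewrite /csq; case: z => b c /=; ring.
have [->|aN0] := eqVneq a 0.
  by rewrite sqrtr0 invr0 expr0n mul0r; exact: positive_rdot_ge0.
rewrite exprVn sqr_sqrtr// mulrC ler_pdivrMr ?lt_neqAle ?a_ge0 1?eq_sym ?aN0//.
exact: positive_CS.
Qed.

Lemma cholesky_step_ge0 x : 0 <= dot (cholesky_step T w x) x.
Proof. by rewrite dot_cholesky_step ler0c subr_ge0 csq_dot_pivot_vector. Qed.

Lemma cholesky_step_ker x : T x = 0 -> cholesky_step T w x = 0.
Proof.
move=> Tx; rewrite /cholesky_step dot_pivot_vector Tx linear0l mulr0.
by rewrite scale0r subr0.
Qed.

Lemma cholesky_step_pivot : cholesky_step T w w = 0.
Proof.
have [a0|aN0] := eqVneq a 0.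
  exact: (cholesky_step_ker (positive_ker lT T0 a0)).
rewrite /cholesky_step dot_pivot_vector [dot _ _](ge0_ReE (T0 w)) -/(rd _ _).
rewrite -/a -rmorphM/= /pivot_vector scalerA -rmorphM/=.
rewrite mulrAC -expr2 exprVn sqr_sqrtr// mulVf//.
by rewrite scale1r subrr.
Qed.

Hypothesis TT : forall x, T (T x) = T x.

Lemma T_pivot_vector : T v = v.
Proof. by rewrite /v /pivot_vector TZ TT. Qed.

Lemma pivot_vector_unit : v = 0 \/ dot v v = 1.
Proof.
have [a0|aN0] := eqVneq a 0.
  by left; rewrite /v /pivot_vector (positive_ker lT T0 a0) scaler0.
right; rewrite {2}/v dot_pivot_vector T_pivot_vector /v /pivot_vector.
rewrite linearZl_LR/= [dot _ _](ge0_ReE (T0 w)) -/(rd _ _) -/a -!rmorphM/=.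
by rewrite mulrA -expr2 exprVn sqr_sqrtr// mulVf.
Qed.

Lemma cholesky_step_vector : cholesky_step T w v = 0.
Proof.
rewrite /cholesky_step T_pivot_vector -/v.
by case: pivot_vector_unit => ->; rewrite ?linear0l ?scaler0 ?scale1r subrr.
Qed.

Lemma cholesky_step_idem x :
  cholesky_step T w (cholesky_step T w x) = cholesky_step T w x.
Proof.
rewrite {1}/cholesky_step (positive_dotC cholesky_step_linear cholesky_step_ge0).
rewrite -/v cholesky_step_vector linear0r scale0r subr0.
by rewrite /cholesky_step TB TZ TT -/v T_pivot_vector.
Qed.

End step.

Section iteration.
Variables (T : H -> H) (w : nat -> H).
Hypotheses (lT : linear T) (T0 : forall x, 0 <= dot (T x) x).
Let Tn := cholesky T w.
Let v := cholesky_vector T w.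

Lemma cholesky_positive n : linear (Tn n) /\ forall x, 0 <= dot (Tn n x) x.
Proof.
elim: n => [//|n [ln pn]].
split; first exact: cholesky_step_linear.
exact: cholesky_step_ge0.
Qed.

Lemma choleskyE n x : Tn n x = T x - \sum_(i < n) dot x (v i) *: v i.
Proof.
elim: n => [|n IH]; first by rewrite big_ord0 subr0.
by rewrite big_ord_recr/= opprD addrA -IH.
Qed.

Lemma rdot_cholesky n x :
  rd (Tn n x) x = rd (T x) x - \sum_(i < n) csq (dot x (v i)).
Proof.
elim: n => [|n IH]; first by rewrite big_ord0 subr0.
have [ln pn] := cholesky_positive n.
by rewrite big_ord_recr/= opprD addrA -IH {1}/rdot dot_cholesky_step.
Qed.

Lemma cholesky_ker m n x : (m <= n)%N -> Tn m x = 0 -> Tn n x = 0.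
Proof.
move=> /subnK <-; elim: (n - m)%N => [//|k IH /IH].
have [ln pn] := cholesky_positive (k + m).
by rewrite addSn /=; exact: cholesky_step_ker.
Qed.

Lemma cholesky_seq0 k n : (k < n)%N -> Tn n (w k) = 0.
Proof.
move=> kn; apply: (cholesky_ker kn) => /=.
by have [lk pk] := cholesky_positive k; exact: cholesky_step_pivot.
Qed.

Hypothesis w_dense : forall x (e : R), 0 < e -> exists k, sq (x - w k) < e.
Variable C : R.
Hypothesis T_bounded : forall x, rd (T x) x <= C * sq x.

(** For [n > k] the symmetric [Tn n] kills [w k], so its form has the same value at [x] and at
    [x - w k]. That value is at most the one of [T], hence at most [C * sq (x - w k)], which density
    makes small. *)
Lemma cvg_cholesky x : (fun n => rd (Tn n x) x) @ \oo --> (0 : R).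
Proof.
apply/cvgrPdist_lt => e e0.
have C0 : 0 < `|C| + 1 by rewrite ltr_wpDl.
have [k hk] := w_dense x (divr_gt0 e0 C0).
near=> n.
have kn : (k < n)%N by near: n; exact: nbhs_infty_gt.
have [ln pn] := cholesky_positive n.
rewrite sub0r normrN ger0_norm ?positive_rdot_ge0//.
have wk := cholesky_seq0 kn.
have -> : rd (Tn n x) x = rd (Tn n (x - w k)) (x - w k).
  have [_ TnB _ _] := linear_comb ln; rewrite TnB.
  by rewrite wk subr0 rdotBr (positive_rdotC ln pn x (w k)) wk /rdot linear0r subr0.
rewrite rdot_cholesky; move: hk; rewrite ltr_pdivlMr//.
have := T_bounded (x - w k).
have s0 : 0 <= \sum_(i < n) csq (dot (x - w k) (v i)).
  by apply: sumr_ge0 => i _; exact: csq_ge0.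
have := nsq_ge0 dot (x - w k); have := ler_norm C; move: (sq _) (rd _ _) s0.
by move=> s r ? ? ? ? ?; nra.
Unshelve. all: by end_near. Qed.

Lemma cvg_cholesky_series x :
  (fun n => \sum_(i < n) csq (dot x (v i))) @ \oo --> rd (T x) x.
Proof.
rewrite (_ : (fun n => _) = fun n => rd (T x) x - rd (Tn n x) x).
  by rewrite -[X in _ --> X]subr0; apply: cvgB; [exact: cvg_cst|exact: cvg_cholesky].
by apply/funext => n; rewrite rdot_cholesky; ring.
Qed.

End iteration.

Hypotheses (normH : hilbert_norm dot) (sepH : separable H).

Lemma separable_seq :
  exists w : nat -> H, forall x (e : R), 0 < e -> exists k, sq (x - w k) < e.
Proof.
have [D cD dD] := sepH.
have near_D x (e : R) : 0 < e -> exists2 y, D y & sq (x - y) < e.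
  move=> e0.
  have se0 : 0 < (Num.sqrt e)%:C :> R[i] by rewrite ltcR sqrtr_gt0.
  have [y [/= xy Dy]] : ball x (Num.sqrt e)%:C `&` D !=set0.
    apply: (dD (ball x (Num.sqrt e)%:C)); first by exists x; exact: ballxx.
    exact: ball_open.
  exists y => //; move: xy; rewrite -ball_normE /= (normE normH) ltcR.
  by rewrite ltr_sqrt.
have /countable_injP[f injf] := cD.
(* The sequence inverts the injection of [D] into [nat]. Indices that code no point of [D] get 0,
   which does not affect density. *)
exists (fun k => xget 0 [set y | D y /\ f y = k]) => x e e0.
have [y Dy xy] := near_D x e e0.
exists (f y); have [Dz fz] :=
  @xgetI _ 0 [set z | D z /\ f z = f y] y (conj Dy erefl).
by rewrite (injf _ _ _ _ fz)// inE.
Qed.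

Lemma positive_operator_series T : positive_operator dot T ->
  exists v : nat -> H, forall x,
    (fun n => \sum_(i < n) csq (dot x (v i))) @ \oo --> rd (T x) x.
Proof.
move=> [bT T0]; have [C C0 hC] := bounded_nsq normH bT.
have [w hw] := separable_seq.
exists (cholesky_vector T w) => x.
(* From [|T y|^2 <= C |y|^2], Cauchy-Schwarz gives [<T y, y> <= sqrt C * |y|^2]. *)
apply: (cvg_cholesky_series bT.1 T0 hw (C := Num.sqrt C)) => y.
have Ty0 := positive_rdot_ge0 T0 y.
have q0 : 0 <= Num.sqrt C * sq y by rewrite mulr_ge0 ?sqrtr_ge0 ?nsq_ge0.
rewrite -(@ler_pXn2r _ 2)//.
rewrite exprMn sqr_sqrtr// (le_trans (CS_re _ _ _))// expr2 mulrA.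
by rewrite ler_wpM2r ?nsq_ge0.
Qed.

(** Uniqueness of traces rests on this: without any basis, [has_trace] would hold vacuously of every
    number. *)
Lemma orthonormal_basis_exists : exists e, orthonormal_basis dot e.
Proof.
have [w hw] := separable_seq.
have l1 : linear (@id H) by [].
have p1 (x : H) : 0 <= dot x x by exact: dnorm_ge0.
pose Tn := cholesky id w; pose v := cholesky_vector id w.
have idem n x : Tn n (Tn n x) = Tn n x.
  elim: n x => [//|n IH] x /=.
  by have [ln pn] := cholesky_positive w l1 p1 n; exact: cholesky_step_idem.
have vj j n : (j < n)%N -> Tn n (v j) = 0.
  move=> jn; apply: (cholesky_ker l1 p1 jn).
  have [lj pj] := cholesky_positive w l1 p1 j.
  by apply: cholesky_step_vector => //; exact: idem.
(* [v j] is a multiple of [Tn j (w j)], and the symmetric [Tn j] kills the earlier [v i]. *)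
have orth i j : (i < j)%N -> dot (v j) (v i) = 0.
  move=> ij; have [lj pj] := cholesky_positive w l1 p1 j.
  rewrite [v j]/(pivot_vector (Tn j) (w j)) linearZl_LR/=.
  have := vj i j ij; rewrite /Tn (positive_dotC lj pj) => ->.
  by rewrite linear0r mulr0.
exists v; split=> [i j|i|x].
- rewrite neq_ltn => /orP[|] ij; last exact: orth.
  by rewrite dot_conj orth// conjc0.
- have [li pi] := cholesky_positive w l1 p1 i.
  by apply: pivot_vector_unit => //; exact: idem.
(* The remainder of the expansion of [x] is [Tn n x]. By idempotence its squared norm is
   [rd (Tn n x) x], which tends to 0. *)
- apply/cvgrPdist_lt => e e0.
  have e1 : 0 < Re e by move: e0; rewrite ltcE => /andP[].
  have cx : (fun n => rd (Tn n x) x) @ \oo --> (0 : R).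
    by apply: (cvg_cholesky l1 p1 hw (C := 1)) => y; rewrite mul1r.
  have /cvgrPdist_lt/(_ (Re e ^+ 2)) := cx.
  rewrite exprn_gt0// => /(_ isT); apply: filterS => n.
  have [ln pn] := cholesky_positive w l1 p1 n.
  have := choleskyE id w n x; rewrite -/v => <-.
  rewrite sub0r normrN ger0_norm ?positive_rdot_ge0// => h.
  rewrite (normE normH) (ge0_ReE (ltW e0)) ltcR.
  rewrite -(@ltr_pXn2r _ 2)// ?nnegrE ?sqrtr_ge0 ?(ltW e1)//.
  rewrite sqr_sqrtr ?nsq_ge0//; apply: le_lt_trans h.
  by rewrite /nsq -(positive_rdotC ln pn) [cholesky _ _ _ _]idem.
Qed.

End cholesky.

(** * Traces *)

Section trace_theory.
Context {R : realType} {H : completeNormedModType R[i]}.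
Variable dot : {dot H for Num.conj}.
Implicit Types (x y : H) (A B T P : H -> H) (e u v w : nat -> H).
Hypotheses (normH : hilbert_norm dot) (sepH : separable H).

Local Notation rd := (rdot dot).
Local Notation sq := (nsq dot).

Lemma csq_dotC x y : csq (dot x y) = csq (dot y x).
Proof. by rewrite dot_conj /csq; case: (dot y x) => a b /=; ring. Qed.

Lemma parseval e x : orthonormal_basis dot e ->
  (fun n => \sum_(i < n) csq (dot x (e i))) @ \oo --> sq x.
Proof.
move=> [_ _ /(_ x)/(cvg_rdotl normH (y := x))/eq_cvgn]; apply => n.
rewrite rdot_suml; apply: eq_bigr => i _.
by rewrite /rdot linearZl_LR/= dot_mul_conj.
Qed.

Lemma parseval_double_series e u : orthonormal_basis dot e ->
  (\sum_(i <oo) \sum_(k <oo) (csq (dot (u k) (e i)))%:E =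
   \sum_(k <oo) (sq (u k))%:E)%E.
Proof.
move=> onb; rewrite nneseries_interchange => [|i j]; last first.
  by rewrite lee_fin csq_ge0.
apply: eq_eseriesr => k _; apply/nnseries_cvgP => [i|]; first exact: csq_ge0.
exact: parseval.
Qed.

(** The double series of [csq (dot (u k) (e i))] is summed in both orders. Domination by [g] makes
    the total finite, and each [b i] is finite as one term of that total. *)
Lemma square_summable e u (g : nat -> R) (S : R) : orthonormal_basis dot e ->
  (forall k, sq (u k) <= g k) -> (fun n => \sum_(k < n) g k) @ \oo --> S ->
  exists (s : R) (b : nat -> R),
  [/\ (fun n => \sum_(k < n) sq (u k)) @ \oo --> s,
      forall i, (fun n => \sum_(k < n) csq (dot (u k) (e i))) @ \oo --> b i &
      (fun n => \sum_(i < n) b i) @ \oo --> s].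
Proof.
move=> onb ug gS.
have g0 k : 0 <= g k by rewrite (le_trans _ (ug k))// nsq_ge0.
pose B i := (\sum_(k <oo) (csq (dot (u k) (e i)))%:E)%E.
have B0 i : (0 <= B i)%E.
  by apply: nneseries_ge0 => k _ _; rewrite lee_fin csq_ge0.
have BS : (\sum_(i <oo) B i = \sum_(k <oo) (sq (u k))%:E)%E.
  exact: parseval_double_series.
have ltS : (\sum_(k <oo) (sq (u k))%:E < +oo)%E.
  apply: (@le_lt_trans _ _ S%:E); last exact: ltry.
  move/nnseries_cvgP: gS => <-//.
  by apply: lee_nneseries => k _; rewrite lee_fin// nsq_ge0.
have s_fin : (\sum_(k <oo) (sq (u k))%:E)%E \is a fin_num.
  rewrite ge0_fin_numE//.
  by apply: nneseries_ge0 => k _ _; rewrite lee_fin nsq_ge0.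
have B_fin i : B i \is a fin_num.
  rewrite ge0_fin_numE//; apply: le_lt_trans ltS; rewrite -BS.
  rewrite (@nneseriesD1 _ _ i)//.
  by rewrite leeDl// nneseries_ge0.
exists (fine (\sum_(k <oo) (sq (u k))%:E)%E), (fine \o B); split=> [|i|].
- by apply: (nnseries_cvgP _ (fun k => nsq_ge0 dot (u k))).2; rewrite fineK.
- apply: (nnseries_cvgP _ (fun k => csq_ge0 (dot (u k) (e i)))).2.
  by rewrite /= fineK.
- have b0 k : 0 <= (fine \o B) k by rewrite /= fine_ge0.
  apply: (nnseries_cvgP _ b0).2.
  by rewrite fineK// -BS; apply: eq_eseriesr => i _; rewrite /= fineK.
Qed.

(** Two terms suffice because only the real part is wanted. Imaginary parts are reached later by
    multiplying a vector by ['i]. *)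
Lemma csq_polarization x y z :
  Re (dot x z * dot z y) = (csq (dot (x + y) z) - csq (dot (x - y) z)) / 4.
Proof.
rewrite (dot_conj dot z y) (linearBl dot) (linearDl dot)/= /csq.
by case: (dot x z) (dot y z) => a b [c f] /=; field.
Qed.

Lemma rdot_polarization x y : rd x y = (sq (x + y) - sq (x - y)) / 4.
Proof. by rewrite nsqD nsqB; field. Qed.

Lemma nsqD_le x y : sq (x + y) <= 2 * sq x + 2 * sq y.
Proof. by have := nsq_ge0 dot (x - y); rewrite nsqB nsqD; lra. Qed.

Lemma nsqN x : sq (- x) = sq x.
Proof. by rewrite /nsq /rdot hnormN. Qed.

(* By polarization the double series of [dot (v k) (e i) * dot (e i) (w k)] is
   a combination of two series with nonnegative terms. *)
Lemma parseval_exchange e v w (Sv Sw : R) (a : nat -> R) : orthonormal_basis dot e ->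
  (fun n => \sum_(k < n) sq (v k)) @ \oo --> Sv ->
  (fun n => \sum_(k < n) sq (w k)) @ \oo --> Sw ->
  (forall i, (fun n => \sum_(k < n) Re (dot (v k) (e i) * dot (e i) (w k)))
     @ \oo --> a i) ->
  exists2 s : R, (fun n => \sum_(i < n) a i) @ \oo --> s &
             (fun n => \sum_(k < n) rd (v k) (w k)) @ \oo --> s.
Proof.
move=> onb hv hw ha.
have hg : (fun n => \sum_(k < n) (2 * sq (v k) + 2 * sq (w k))) @ \oo -->
    2 * Sv + 2 * Sw.
  rewrite (_ : (fun n => _) = fun n =>
      2 * (\sum_(k < n) sq (v k)) + 2 * (\sum_(k < n) sq (w k))).
    by apply: cvgD; apply: cvgMl_tmp.
  by apply/funext => n; rewrite big_split/= -!mulr_sumr.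
have [sp [bp [hp hbp hsp]]] :=
  square_summable (u := fun k => v k + w k) onb (fun k => nsqD_le _ _) hg.
have mle k : sq (v k - w k) <= 2 * sq (v k) + 2 * sq (w k).
  by rewrite (le_trans (nsqD_le _ _))// nsqN.
have [sm [bm [hm hbm hsm]]] :=
  square_summable (u := fun k => v k - w k) onb mle hg.
have aE i : a i = (bp i - bm i) / 4.
  apply: (cvg_unique _ (ha i)) => //.
  rewrite (_ : (fun n => _) = fun n =>
    (\sum_(k < n) csq (dot (v k + w k) (e i)) -
     \sum_(k < n) csq (dot (v k - w k) (e i))) / 4).
    by apply: cvgMr_tmp; exact: cvgB.
  apply/funext => n; rewrite -sumrB mulr_suml; apply: eq_bigr => k _.
  exact: csq_polarization.
exists ((sp - sm) / 4).
- rewrite (_ : (fun n => _) = fun n =>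
    (\sum_(i < n) bp i - \sum_(i < n) bm i) / 4).
    by apply: cvgMr_tmp; exact: cvgB.
  by apply/funext => n; rewrite -sumrB mulr_suml; apply: eq_bigr => i _.
- rewrite (_ : (fun n => _) = fun n =>
    (\sum_(k < n) sq (v k + w k) - \sum_(k < n) sq (v k - w k)) / 4).
    by apply: cvgMr_tmp; exact: cvgB.
  apply/funext => n; rewrite -sumrB mulr_suml; apply: eq_bigr => i _.
  exact: rdot_polarization.
Qed.

Lemma has_trace_unique A s t : has_trace dot A s -> has_trace dot A t -> s = t.
Proof.
have [e onb] := orthonormal_basis_exists normH sepH.
by move=> /(_ e onb) hs /(_ e onb) ht; exact: (cvg_unique _ hs ht).
Qed.

Lemma has_traceE A t : has_trace dot A t -> trace dot A = t.
Proof.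
move=> ht; apply: (has_trace_unique _ ht).
exact: (@xgetI _ 0 [set t | has_trace dot A t] t ht).
Qed.

Lemma density_has_trace A : density_operator dot A -> has_trace dot A 1.
Proof.
move=> [_]; rewrite /trace; case: xgetP => [t -> ht <-//|_ /eqP].
by rewrite eq_sym oner_eq0.
Qed.

Lemma has_traceD A B s t : has_trace dot A s -> has_trace dot B t ->
  has_trace dot (fun x => A x + B x) (s + t).
Proof.
move=> hA hB e onb.
rewrite (_ : (fun n => _) = fun n => \sum_(i < n) dot (A (e i)) (e i) +
   \sum_(i < n) dot (B (e i)) (e i) : R[i]^o).
  by apply: cvgD; [exact: hA|exact: hB].
by apply/funext => n; rewrite -big_split; apply: eq_bigr => i _; rewrite linearDl.
Qed.

Lemma has_traceZ A c t : has_trace dot A t ->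
  has_trace dot (fun x => c *: A x) (c * t).
Proof.
move=> hA e onb.
rewrite (_ : (fun n => _) =
    fun n => c * \sum_(i < n) dot (A (e i)) (e i) : R[i]^o).
  by apply: cvgMl_tmp; exact: hA.
by apply/funext => n; rewrite mulr_sumr; apply: eq_bigr => i _; rewrite linearZl_LR.
Qed.

Lemma has_trace0 : has_trace dot (fun=> 0) 0.
Proof.
move=> e onb; rewrite (_ : (fun n => _) = cst 0); first exact: cvg_cst.
by apply/funext => n; rewrite big1// => i _; rewrite linear0l.
Qed.

Lemma has_trace_sum I (s : seq I) (A : I -> H -> H) (t : I -> R[i]) :
  (forall i, has_trace dot (A i) (t i)) ->
  has_trace dot (fun x => \sum_(i <- s) A i x) (\sum_(i <- s) t i).
Proof.
move=> hA; elim: s => [|i s IH].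
  rewrite big_nil (_ : (fun x => _) = fun=> 0); first exact: has_trace0.
  by apply/funext => x; rewrite big_nil.
rewrite big_cons (_ : (fun x => _) = fun x => A i x + \sum_(j <- s) A j x).
  exact: (has_traceD (hA i) IH).
by apply/funext => x; rewrite big_cons.
Qed.

Section positive_series.
Variables (T : H -> H) (v : nat -> H).
Hypotheses (Tpos : positive_operator dot T)
  (Tv : forall x,
    (fun n => \sum_(i < n) csq (dot x (v i))) @ \oo --> rd (T x) x).

(** Each diagonal term [rd (T (e i)) (e i)] is [\sum_k |<e i, v k>|^2]. Exchanging the sums over [i]
    and [k] leaves [\sum_k |v k|^2] by Parseval. *)
Lemma cvg_trace_series t : has_trace dot T t ->
  (fun n => \sum_(k < n) sq (v k)) @ \oo --> Re t.
Proof.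
have [e onb] := orthonormal_basis_exists normH sepH.
move=> /(_ e onb)/cvg_complexP[ht _].
apply: (nnseries_cvgP _ (fun k => nsq_ge0 dot (v k))).2.
rewrite -(parseval_double_series _ onb).
have Re0 i : 0 <= rd (T (e i)) (e i) by exact: (positive_rdot_ge0 Tpos.2).
transitivity (\sum_(i <oo) (rd (T (e i)) (e i))%:E)%E.
  apply: eq_eseriesr => i _; apply/nnseries_cvgP => [k|]; first exact: csq_ge0.
  by under eq_fun do under eq_bigr do rewrite csq_dotC; exact: Tv.
by apply/nnseries_cvgP => //; apply: (eq_cvgn ht) => n; rewrite Re_sum.
Qed.

Lemma cvg_rdot_series x y :
  (fun n => \sum_(i < n) Re (dot x (v i) * dot (v i) y)) @ \oo --> rd (T x) y.
Proof.
have [lT T0] := (Tpos.1.1, Tpos.2); have [TD TB _ _] := linear_comb lT.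
have -> : rd (T x) y = (rd (T (x + y)) (x + y) - rd (T (x - y)) (x - y)) / 4.
  rewrite TD TB !(rdotBl, rdotBr, rdotDl, rdotDr).
  by rewrite (positive_rdotC lT T0 y x) (rdotC dot y (T x)); field.
apply: eq_cvgn; first by apply: cvgMr_tmp; apply: cvgB; exact: Tv.
move=> n; rewrite fctE.
rewrite -sumrB mulr_suml; apply: eq_bigr => i _.
by rewrite csq_polarization.
Qed.

(** Cauchy-Schwarz in each term, [|<x, v k>|^2 <= |v k|^2 |x|^2]: the trace bounds the operator
    norm. *)
Lemma positive_le_trace t x : has_trace dot T t -> rd (T x) x <= Re t * sq x.
Proof.
move=> /cvg_trace_series ht.
have h : (fun n => (\sum_(k < n) sq (v k)) * sq x) @ \oo --> Re t * sq x.
  exact: cvgMr_tmp.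
apply: (ler_cvg_to (@Tv x) h).
apply: nearW => n; rewrite mulr_suml; apply: ler_sum => i _.
by rewrite mulrC CS.
Qed.

(** Expanding [T] along [v] and moving [B] across by symmetry turns a diagonal term into
    [\sum_k <e i, B (v k)> <v k, e i>], and [parseval_exchange] then sums over [i] first. The unit
    scalar [c] selects the real part ([c = 1]) or the imaginary part ([c = 'i]). The limit involves
    only [v] and [B], hence is common to all bases. *)
Lemma has_trace_comp B t : has_trace dot T t -> positive_operator dot B ->
  exists2 s : R, has_trace dot (T \o B) s%:C &
    (fun n => \sum_(k < n) rd (B (v k)) (v k)) @ \oo --> s.
Proof.
move=> /cvg_trace_series ht Bpos.
have [lB B0] := (Bpos.1.1, Bpos.2).
have [C C0 hC] := bounded_nsq normH Bpos.1.
have [e0 onb0] := orthonormal_basis_exists normH sepH.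
have summ (c : R[i]) : csq c = 1 -> exists S : R,
    (fun n => \sum_(k < n) sq (c *: B (v k))) @ \oo --> S.
  move=> c1; have Bg k : sq (c *: B (v k)) <= C * sq (v k).
    rewrite (le_trans _ (hC _))// -lecR -!dotxx dnormZ -add_Re2_Im2.
    by rewrite [_ + _]c1 mul1r.
  have [|s [b [hs _ _]]] := square_summable onb0 Bg (S := C * Re t).
    apply: eq_cvgn; first by apply: cvgMl_tmp; exact: ht.
    by move=> n; rewrite mulr_sumr.
  by exists s.
have exch e (c : R[i]) : orthonormal_basis dot e -> csq c = 1 ->
  exists2 s : R, (fun n => \sum_(i < n) rd (T (B (e i))) (c *: e i)) @ \oo --> s &
             (fun n => \sum_(k < n) rd (v k) (c *: B (v k))) @ \oo --> s.
  move=> onb c1; have [S hS] := summ c c1.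
  have ha i : (fun n => \sum_(k < n) Re (dot (v k) (e i) *
      dot (e i) (c *: B (v k)))) @ \oo --> rd (T (B (e i))) (c *: e i).
    apply: (eq_cvgn (@cvg_rdot_series (B (e i)) (c *: e i))) => n.
    apply: eq_bigr => k _.
    rewrite !(linearZr_LR dot)/= (positive_dotC lB B0).
    by congr Re; rewrite mulrCA [RHS]mulrCA [X in _ * X = _]mulrC.
  exact: (@parseval_exchange e v (fun k => c *: B (v k)) (Re t) S _ onb ht hS ha).
have csq1 : csq (1 : R[i]) = 1 by rewrite /csq /= expr1n expr0n addr0.
have csqi : csq ('i : R[i]) = 1 by rewrite /csq /= expr1n expr0n add0r.
have [s _ hs] := exch e0 1 onb0 csq1.
have hs' : (fun n => \sum_(k < n) rd (B (v k)) (v k)) @ \oo --> s.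
  apply: (eq_cvgn hs) => n.
  by apply: eq_bigr => k _; rewrite scale1r rdotC.
exists s => // e onb; apply/cvg_complexP; split.
- have [r hr hr'] := exch e 1 onb csq1.
  rewrite /= (cvg_unique _ hs hr')//.
  apply: (eq_cvgn hr) => n.
  by rewrite Re_sum; apply: eq_bigr => i _; rewrite scale1r.
- have [r hr hr'] := exch e 'i onb csqi.
  (* [rd (v k) ('i *: B (v k))] is the imaginary part of [<v k, B (v k)>], a real number because [B]
     is positive. *)
  have r0 : r = 0.
    apply: (cvg_unique _ hr') => //; rewrite (_ : (fun n => _) = cst 0).
      exact: cvg_cst.
    apply/funext => n; rewrite big1// => k _.
    have := ge0_ReE (B0 (v k)); rewrite (positive_dotC lB B0) dotE.
    by case.
  rewrite [Im _]/= -r0; apply: (eq_cvgn hr) => n.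
  by rewrite Im_sum; apply: eq_bigr => i _; rewrite [in RHS]dotE.
Qed.

End positive_series.

End trace_theory.

(** * Positivity of Bochner integrals *)

Section bochner_positivity.
Context {R : realType} {H : completeNormedModType R[i]}.
Variable dot : {dot H for Num.conj}.
Implicit Types (x y : H) (A B T P : H -> H).
Hypotheses (normH : hilbert_norm dot) (sepH : separable H).

Local Notation rd := (rdot dot).
Local Notation sq := (nsq dot).

Lemma trace_ge0 T t : positive_operator dot T -> has_trace dot T t -> 0 <= Re t.
Proof.
move=> Tpos ht; have [v Tv] := positive_operator_series normH sepH Tpos.
have h := cvg_trace_series normH sepH Tpos Tv ht.
apply: (ler_cvg_to (cvg_cst (0 : R)) h).
by apply: nearW => n; apply: sumr_ge0 => k _; exact: nsq_ge0.
Qed.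

(** [|A x| = |P x|], and the norm of [P] is at most its trace. The vector [y] is any one as long as
    [x], so as to cover [x] and its multiples by ['i] and [-'i]. *)
Lemma modulus_trace_bound A P t x y : is_modulus dot A P -> has_trace dot P t ->
  sq y = sq x -> `|rd (A x) y| <= Re t * sq x.
Proof.
move=> [Ppos [B AB PB]] ht yx.
have t0 := trace_ge0 Ppos ht.
have [v Pv] := positive_operator_series normH sepH Ppos.
have Pt z := positive_le_trace normH sepH Ppos Pv z ht.
have [lP P0] := (Ppos.1.1, Ppos.2).
have AP : sq (A x) = sq (P x).
  rewrite /nsq (positive_rdotC lP P0) /rdot AB.
  by have /(congr1 (fun f => f x)) /= <- := PB.
(* Cauchy-Schwarz for the form of [P] at [x] and [P x] gives [|P x|^4 <= (t |x|^2) (t |P x|^2)]; one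
   factor [|P x|^2] cancels. *)
have Psq : sq (P x) <= Re t * (Re t * sq x).
  have [->|P1] := eqVneq (sq (P x)) 0; first by rewrite !mulr_ge0 ?nsq_ge0.
  have Pgt : 0 < sq (P x) by rewrite lt_neqAle eq_sym P1 nsq_ge0.
  rewrite -(ler_pM2r Pgt).
  have := ler_pM (positive_rdot_ge0 P0 x) (positive_rdot_ge0 P0 (P x))
    (Pt x) (Pt (P x)).
  have := positive_CS_re lP P0 x (P x); rewrite -/(sq (P x)) expr2.
  by move=> h1 /(le_trans h1); congr (_ <= _); ring.
rewrite -(@ler_pXn2r _ 2)// ?nnegrE ?mulr_ge0 ?nsq_ge0//.
rewrite real_normK ?num_real// (le_trans (CS_re _ _ _))// yx AP.
apply: le_trans (ler_wpM2r (nsq_ge0 dot x) Psq) _.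
by rewrite le_eqVlt; apply/orP; left; apply/eqP; ring.
Qed.

Lemma trace_norm_ge0 A : (0 <= trace_norm dot A)%E.
Proof.
rewrite /trace_norm; case: xgetP => // e -> [t [P [Ppos _] ht] <-].
by rewrite lee_fin; exact: (trace_ge0 Ppos ht).
Qed.

Lemma trace_norm_bound A x y : sq y = sq x ->
  (`|rd (A x) y|%:E <= trace_norm dot A * (sq x)%:E)%E.
Proof.
move=> yx; rewrite /trace_norm; case: xgetP => [e -> [t [P PA ht] <-]|_].
  by rewrite -EFinM lee_fin; exact: modulus_trace_bound PA ht yx.
(* Here the trace norm is the default [+oo]. As [+oo * 0 = 0], the case [x = 0] is checked apart. *)
have [x0|xN0] := eqVneq (sq x) 0.
  have y0 : y = 0 by apply: (nsq_eq0 (dot := dot)); rewrite yx.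
  by rewrite x0 mule0 y0 /rdot linear0r normr0.
by rewrite gt0_mulye ?leey// lte_fin lt_neqAle eq_sym xN0 nsq_ge0.
Qed.

Section integral.
Context d (T : measurableType d) (mu : probability T R).
Implicit Types (s F : T -> H -> H).

(** Where [rd (s t x) y] is negative, it differs from the nonnegative [rd (F t x) y] by at least its
    absolute value, so the trace norm of [F t \- s t] controls this negative part. *)
Lemma simple_integral_bound F s x y : simple_operator_function dot s ->
  mu.-integrable setT (fun t => trace_norm dot (F t \- s t)) ->
  sq y = sq x -> (forall t, 0 <= rd (F t x) y) ->
  ((- rd (simple_integral mu s x) y)%:E <=
   (\int[mu]_t trace_norm dot (F t \- s t)%R) * (sq x)%:E)%E.
Proof.
move=> [fins ms _] /measurable_int mtn yx F0.
rewrite -ge0_integralZr//; last 2 first.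
- by move=> t _; exact: trace_norm_ge0.
- by rewrite lee_fin nsq_ge0.
(* Truncation at 0 makes the integrand nonnegative, so it can be split over the finitely many values
   of [s] in [\bar R]. *)
pose c (A : H -> H) : R := Num.max 0 (- rd (A x) y).
have c0 A : 0 <= c A by rewrite le_max lexx.
have cs t : ((c (s t))%:E <= trace_norm dot (F t \- s t)%R * (sq x)%:E)%E.
  rewrite /c EFin_max ge_max mule_ge0 ?trace_norm_ge0 ?lee_fin ?nsq_ge0//=.
  apply: le_trans (trace_norm_bound (F t \- s t) yx); rewrite lee_fin.
  apply: le_trans (ler_norm _); by rewrite /= rdotBl lerDr.
pose E A := s @^-1` [set A].
have mE A : measurable (E A) by exact: ms.
pose g A t : \bar R := ((c A)%:E * (\1_(E A) t)%:E)%E.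
have mg A : measurable_fun setT (g A).
  by apply: emeasurable_funM => //; apply/measurable_EFinP.
have cE : (fun t => (c (s t))%:E) = (fun t =>
    \sum_(A <- fset_set (range s)) g A t)%E.
  apply/funext => t.
  rewrite (bigD1_seq (s t)) ?fset_uniq//=; last first.
    rewrite in_fset_set// inE.
    by exists t.
  rewrite /g indicE mem_set// mule1 big1 ?adde0// => A As.
  by rewrite indicE memNset ?mule0// => /= /esym/eqP; rewrite (negPf As).
apply: (@le_trans _ _ (\int[mu]_t (c (s t))%:E)%E); last first.
  apply: ge0_le_integral => //.
  - by move=> t _; rewrite lee_fin.
  - by rewrite cE; exact: emeasurable_sum.
  - exact: emeasurable_funM.
rewrite /simple_integral (fsbig_finite _ _ fins)//= rdot_suml cE.
rewrite ge0_integral_sum//; last first.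
  by move=> A t _; rewrite mule_ge0// lee_fin// indicE.
rewrite -sumrN -sumEFin; apply: lee_sum => A _.
rewrite ge0_integralZl//; last 2 first.
- by apply/measurable_EFinP.
- by rewrite lee_fin.
rewrite integral_indic// setIT rdotZl -mulrN mulrC EFinM fineK ?fin_num_measure//.
by rewrite lee_wpmul2r// lee_fin le_max lexx orbT.
Qed.

Lemma bochner_rdot_ge0 F A x y : is_bochner_integral dot mu F A ->
  sq y = sq x -> (forall t, 0 <= rd (F t x) y) -> 0 <= rd (A x) y.
Proof.
move=> [_ [s [simple int cF cA]]] yx F0.
(* The two zeros are the limits of the two errors: the mean distance from [F] to [s n], and the
   distance from [A] to the integral of [s n]. *)
have h : ((- rd (A x) y)%:E <= (0 + 0) * (sq x)%:E)%E.
  apply: (@cvge_ge _ _ _ _ _ _ _ _ (cvgeZr _ (cvgeD _ cF cA))) => //.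
  apply: nearW => n.
  rewrite ge0_muleDl ?trace_norm_ge0 ?integral_ge0//; last first.
    by move=> *; exact: trace_norm_ge0.
  have -> : - rd (A x) y = - rd (simple_integral mu (s n) x) y +
      - rd ((A \- simple_integral mu (s n)) x) y.
    by rewrite /= rdotBl; ring.
  rewrite EFinD leeD//; first exact: simple_integral_bound.
  apply: le_trans (trace_norm_bound _ yx); rewrite lee_fin -normrN.
  exact: ler_norm.
by move: h; rewrite adde0 mul0e lee_fin oppr_le0.
Qed.

(** Nonnegativity in [R[i]] includes being real. The imaginary part [rd (A x) ('i *: x)] vanishes
    because [bochner_rdot_ge0] applies to both ['i *: x] and its opposite. *)
Lemma bochner_positive F A : is_bochner_integral dot mu F A ->
  (forall t x, 0 <= dot (F t x) x) -> forall x, 0 <= dot (A x) x.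
Proof.
move=> FA F0 x.
have Fre t : 0 <= rd (F t x) x by exact: positive_rdot_ge0 (F0 t) x.
have Fim t : rd (F t x) ('i *: x) = 0.
  by have := ge0_ReE (F0 t x); rewrite dotE; case.
have csqi : sq ('i *: x) = sq x.
  apply: complexI; rewrite -!dotxx dnormZ -add_Re2_Im2 /=.
  by rewrite expr0n expr1n add0r mul1r.
rewrite dotE.
have -> : rd (A x) ('i *: x) = 0.
  apply/eqP; rewrite eq_le (bochner_rdot_ge0 FA csqi) => [|t]; last by rewrite Fim.
  rewrite andbT -oppr_ge0.
  have : 0 <= rd (A x) (- ('i *: x)).
    apply: (bochner_rdot_ge0 FA) => [|t]; first by rewrite nsqN.
    by rewrite -sub0r rdotBr Fim /rdot linear0r subr0.
  by rewrite -sub0r rdotBr {1}/rdot linear0r sub0r.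
by rewrite ler0c; exact: (bochner_rdot_ge0 FA).
Qed.

End integral.

End bochner_positivity.

(** * Laws of a POVM *)

(* A fresh carrier: [discrete_topology] already has its pointed instances fixed
   at [bool] by the library. *)
Definition discrete_space (T : Type) : Type := T.

Section discrete_space.
Variable T : pointedType.
Local Notation D := (discrete_space T).

HB.instance Definition _ := Pointed.copy D T.
HB.instance Definition _ := hasNbhs.Build D principal_filter.
HB.instance Definition _ := Discrete_ofNbhs.Build D erefl.
HB.instance Definition _ := DiscreteUniform_ofNbhs.Build D.

Lemma discrete_cauchy_cvg (F : set_system D) :
  ProperFilter F -> cauchy F -> cvg F.
Proof.
move=> PF cF; have [|[A B] /= [FA FB] AB] := cF [set xy | xy.1 = xy.2].
  by rewrite uniform_discrete; move=> -[x y] /= [z _ [<- <-]].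
have [x Bx] := filter_ex FB.
apply/cvg_ex; exists x; apply/discrete_cvg.
by apply: filterS FA => y Ay /=; exact: (AB (y, x)).
Qed.

HB.instance Definition _ := Uniform_isComplete.Build D discrete_cauchy_cvg.

End discrete_space.

HB.instance Definition _ (R : numDomainType) (T : pointedType) :=
  @DiscretePseudoMetric_ofUniform.Build R (discrete_space T).

(** Needed for the label measurement to be itself in the class, since [povm] asks for a standard
    Borel outcome space. *)
Lemma discrete_standard_borel (R : realType) d (Z : measurableType d) :
  finite_set [set: Z] -> (forall B : set Z, measurable B) ->
  standard_borel R Z.
Proof.
move=> finZ discZ.
exists (discrete_space Z : completePseudoMetricType R), id; split.
- exact: discrete_hausdorff.
- exists setT; first exact: finite_set_countable.
  by move=> O [x Ox] _; exists x.
- by exists id.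
- move=> B; split=> // _; rewrite image_id.
  by apply: sub_sigma_algebra; exact: discrete_open.
Qed.

Section povm_law.
Context {R : realType} {H : completeNormedModType R[i]}.
Variable dot : {dot H for Num.conj}.
Hypotheses (normH : hilbert_norm dot) (sepH : separable H).
Context d (Y : measurableType d) (N : set Y -> H -> H).

Local Notation rd := (rdot dot).
Local Notation sq := (nsq dot).

(* Outside the sigma-algebra [N B] is arbitrary, hence the absolute value. *)
Definition povm_vector_measure of povm dot N := fun (x : H) (B : set Y) =>
  (`|rd (N B x) x|%:E : \bar R).

Hypothesis NP : povm dot N.

Lemma povm_rdot_ge0 B x : measurable B -> 0 <= rd (N B x) x.
Proof. by case: NP => _ Npos _ _ /Npos[_ N0]; exact: (positive_rdot_ge0 N0). Qed.

Lemma cvg_povm_rdot x (F : (set Y)^nat) :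
  (forall n, measurable (F n)) -> trivIset setT F ->
  (fun n => \sum_(k < n) rd (N (F k) x) x) @ \oo --> rd (N (\bigcup_n F n) x) x.
Proof.
case: NP => _ _ Nadd _ mF tF.
have /cvg_complexP[h _] := Nadd F mF tF x x.
by apply: (eq_cvgn h) => n; rewrite Re_sum.
Qed.

Section vector.
Variable x : H.

(** Countable additivity on a sequence of empty sets: the partial sums of a constant [c] tend to
    [c], and shifted by one to [c + c]. *)
Let vector_measure0 : povm_vector_measure NP x set0 = 0%E.
Proof.
have tF : trivIset setT (fun _ : nat => set0 : set Y).
  by apply/trivIsetP => i j *; rewrite set0I.
have := @cvg_povm_rdot x _ (fun=> measurable0) tF; rewrite bigcup0//.
set c := rd _ _ => cc; rewrite /povm_vector_measure -/c.
have : (fun n => \sum_(k < n.+1) c) @ \oo --> c + c.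
  apply: (@eq_cvgn _ (fun n => \sum_(k < n) c + c)).
    by apply: cvgD => //; exact: cvg_cst.
  by move=> n; rewrite big_ord_recr.
have c1 : (fun n => \sum_(k < n.+1) c) @ \oo --> c.
  by rewrite (cvg_shiftS (fun n => \sum_(k < n) c)).
move=> /(cvg_unique _ c1) => /(_ (@Rhausdorff R)) /eqP.
by rewrite -subr_eq0 opprD addrA subrr sub0r oppr_eq0 => /eqP ->; rewrite normr0.
Qed.

Let vector_measure_ge0 B : (0 <= povm_vector_measure NP x B)%E.
Proof. by rewrite lee_fin. Qed.

Let vector_measure_sigma_additive : semi_sigma_additive (povm_vector_measure NP x).
Proof.
move=> F mF tF mUF; rewrite /povm_vector_measure ger0_norm ?povm_rdot_ge0//.
apply: (@eq_cvgn _ (fun n => (\sum_(k < n) rd (N (F k) x) x)%:E)).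
  by apply: cvg_EFin; [exact: nearW|exact: cvg_povm_rdot].
move=> n; rewrite sumEFin big_mkord; congr _%:E; apply: eq_bigr => k _.
by rewrite ger0_norm ?povm_rdot_ge0.
Qed.

HB.instance Definition _ := isMeasure.Build d Y R (povm_vector_measure NP x)
  vector_measure0 vector_measure_ge0 vector_measure_sigma_additive.

End vector.

Variable v : nat -> H.
Hypothesis v_unit : (fun n => \sum_(k < n) sq (v k)) @ \oo --> (1 : R).

(* The law [B |-> Tr (T \o N B)] of the state [T x = \sum_k dot x (v k) *: v k]. *)
Definition povm_law of (fun n => \sum_(k < n) sq (v k)) @ \oo --> (1 : R) :=
  mseries (fun k => povm_vector_measure NP (v k)) 0.

HB.instance Definition _ := Measure.on (povm_law v_unit).

Let povm_law_setT : povm_law v_unit setT = 1%E.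
Proof.
rewrite /povm_law /mseries; transitivity (\sum_(k <oo) (sq (v k))%:E)%E.
  apply: eq_eseriesr => k _ /=; rewrite /povm_vector_measure.
  by case: NP => _ _ _ ->; rewrite ger0_norm ?nsq_ge0.
by apply/nnseries_cvgP => // k; exact: nsq_ge0.
Qed.

HB.instance Definition _ :=
  Measure_isProbability.Build _ _ _ (povm_law v_unit) povm_law_setT.

End povm_law.

Lemma povm_law_trace (R : realType) (H : completeNormedModType R[i])
    (dot : {dot H for Num.conj}) d (Y : measurableType d)
    (N : set Y -> H -> H) (tau : H -> H) :
  hilbert_norm dot -> separable H -> povm dot N -> density_operator dot tau ->
  exists P : probability Y R, forall B, measurable B ->
    has_trace dot (tau \o N B) (fine (P B))%:C.
Proof.
move=> normH sepH NP tauD.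
have ht := density_has_trace tauD.
have [v tauv] := positive_operator_series normH sepH tauD.1.
have hv := cvg_trace_series normH sepH tauD.1 tauv ht.
exists (povm_law NP hv : probability Y R) => B mB.
have NB : positive_operator dot (N B) by case: NP => _ /(_ B mB).
have [s hs sv] := has_trace_comp normH sepH tauD.1 tauv ht NB.
have lawE : povm_law NP hv B = s%:E.
  rewrite /povm_law /mseries.
  rewrite -[RHS](nnseries_cvgP _ (fun k => povm_rdot_ge0 NP (v k) mB)).1//.
  apply: eq_eseriesr => k _ /=; rewrite /povm_vector_measure.
  by rewrite ger0_norm ?povm_rdot_ge0.
by rewrite (_ : fine _ = s)// -[LHS]/(fine (povm_law NP hv B)) lawE.
Qed.

(** * Block-diagonal states *)

Section block_decomposition.
Context {R : realType} {H : completeNormedModType R[i]}.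
Variable dot : {dot H for Num.conj}.
Context dZ (Z : measurableType dZ).
Variables (Hz : Z -> set H) (Pi : Z -> H -> H).
Hypotheses (finZ : finite_set [set: Z]) (discZ : forall B : set Z, measurable B)
  (HzP : orthogonal_decomposition dot Hz)
  (PiP : forall z, orthogonal_projection dot (Hz z) (Pi z))
  (Pi_bounded : forall z, bounded_operator (Pi z)).

Local Notation labels := (fset_set [set: Z]).

Lemma labels_mem z : z \in labels.
Proof. by rewrite in_fset_set// in_setT. Qed.

Lemma fsbig_labels (V : nmodType) (B : set Z) (F : Z -> V) :
  \sum_(z \in B) F z = \sum_(z <- labels) (if z \in B then F z else 0).
Proof. by rewrite fsbig_mkcond (fsbig_finite _ _ finZ). Qed.

Lemma block_labelE (B : set Z) x :
  block_label Pi B x = \sum_(z <- labels) (if z \in B then Pi z x else 0).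
Proof. exact: fsbig_labels. Qed.

Lemma dot_suml I (s : seq I) (F : I -> H) y :
  dot (\sum_(i <- s) F i) y = \sum_(i <- s) dot (F i) y.
Proof.
by apply: (big_morph (dot^~ y)) => [a b|]; rewrite ?linearDl ?linear0l.
Qed.

Lemma dot_projectionl z x y : Hz z y -> dot (x - Pi z x) y = 0.
Proof. by move=> zy; exact: (PiP z x).2. Qed.

Lemma dot_Pi z x : dot (Pi z x) x = dot (Pi z x) (Pi z x).
Proof.
have := dot_projectionl x (PiP z x).1.
rewrite (linearBl dot)/= => /eqP; rewrite subr_eq0 => /eqP xE.
by rewrite dot_conj xE -dot_conj.
Qed.

(** The component [v z] of [x] is [Pi z x]: their difference lies in [Hz z] and is orthogonal to
    [Hz z]. *)
Lemma Pi_sum x : \sum_(z <- labels) Pi z x = x.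
Proof.
have [subHz _ orthHz] := HzP; move=> /(_ x)[v vz].
rewrite (fsbig_finite _ _ finZ)/= => xE.
rewrite [RHS]xE; apply: eq_bigr => z _.
apply/eqP; rewrite -subr_eq0 -(dnorm_eq0 dot); apply/eqP.
have zPv : Hz z (Pi z x - v z).
  by have := (subHz z).2 (-1) _ _ (vz z) (PiP z x).1; rewrite scaleN1r addrC.
have xv y : Hz z y -> dot (x - v z) y = 0.
  move=> zy; rewrite {1}xE (bigD1_seq z) ?fset_uniq ?labels_mem//=.
  rewrite addrAC subrr add0r big_mkcond dot_suml big1// => w _.
  by case: ifPn => [wz|_]; [exact: orthHz wz (vz w) zy|rewrite linear0l].
move: zPv; set u := Pi z x - v z => zu.
have uE : u = (x - v z) - (x - Pi z x).
  by rewrite opprB [RHS]addrC addrA subrK.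
by rewrite {1}uE (linearBl dot)/= xv// dot_projectionl// subrr.
Qed.

Lemma bounded_operator_sum (s : seq Z) (B : set Z) :
  bounded_operator (fun x => \sum_(z <- s) (if z \in B then Pi z x else 0)).
Proof.
split.
  move=> a x y; rewrite scaler_sumr -big_split; apply: eq_bigr => z _ /=.
  by case: ifP => _; rewrite ?(Pi_bounded z).1 ?scaler0 ?addr0.
elim: s => [|z s [M IH]].
  by exists 0 => x; rewrite big_nil normr0 mul0r.
have [_ [M' hM']] := Pi_bounded z.
exists ((if z \in B then M' else 0) + M) => x.
rewrite big_cons mulrDl (le_trans (ler_normD _ _))// lerD//.
by case: ifP => _; rewrite ?normr0 ?mul0r.
Qed.

Lemma block_label_positive B : positive_operator dot (block_label Pi B).
Proof.
split.
  have := bounded_operator_sum labels B; congr bounded_operator.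
  by apply/funext => x; rewrite block_labelE.
move=> x; rewrite block_labelE dot_suml; apply: sumr_ge0 => z _.
by case: ifP => _; rewrite ?linear0l// dot_Pi dnorm_ge0.
Qed.

(** At most one [F k] contains [z], so the partial sums are eventually constant. *)
Lemma cvg_indic_trivIset (F : (set Z)^nat) (c : R[i]) z (l : R[i]^o) :
  trivIset setT F -> l = (if z \in \bigcup_n F n then c else 0) ->
  (fun n => \sum_(k < n) (if z \in F k then c else 0) : R[i]^o) @ \oo --> l.
Proof.
move=> tF ->; apply: cvg_near_cst.
case: ifPn => [/set_mem[k _ Fkz]|/negP nF]; last first.
  apply: nearW => n; rewrite big1// => k _; rewrite memNset// => Fkz.
  by apply: nF; apply/mem_set; exists k.
near=> n.
have kn : (k < n)%N by near: n; exact: nbhs_infty_gt.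
rewrite (bigD1 (Ordinal kn))//= mem_set// big1 ?addr0// => j jk.
rewrite memNset// => Fjz.
have /eqP := jk; apply; apply/val_inj => /=.
by apply: (tF _ _ I I); exists z.
Unshelve. all: by end_near. Qed.

Lemma block_label_povm : povm dot (block_label Pi).
Proof.
split.
- exact: discrete_standard_borel.
- by move=> B _; exact: block_label_positive.
- move=> F _ tF x y; rewrite block_labelE dot_suml.
  apply: (@eq_cvgn _ (fun n => \sum_(z <- labels) \sum_(k < n)
      (if z \in F k then dot (Pi z x) y else 0) : R[i]^o)).
    apply: cvgn_sum => z; apply: cvg_indic_trivIset => //.
    by case: ifP => _ //; rewrite linear0l.
  move=> n; rewrite exchange_big; apply: eq_bigr => k _ /=.
  rewrite block_labelE dot_suml; apply: eq_bigr => z _.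
  by case: ifP => _ //; rewrite linear0l.
- apply/funext => x; rewrite block_labelE -[RHS]Pi_sum.
  by apply: eq_bigr => z _; rewrite in_setT.
Qed.

Section block_diagonal.
Hypotheses (normH : hilbert_norm dot) (sepH : separable H).
Variable tau : Z -> H -> H.
Hypothesis tauP : forall z, density_operator_on dot (Hz z) (tau z).

Lemma tau_linear z : linear (tau z).
Proof. by have [[[[]]]] := tauP z. Qed.

Lemma tau_has_trace z : has_trace dot (tau z) 1.
Proof. by apply: density_has_trace; case: (tauP z). Qed.

Lemma tau_Pi z x : tau z (Pi z x) = tau z x.
Proof.
have [_ _ t0] := tauP z; have [_ tB _ _] := linear_comb (tau_linear z).
apply/esym/eqP; rewrite -subr_eq0 -tB; apply/eqP; apply: t0 => y.
exact: dot_projectionl.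
Qed.

Lemma tau_Pi_neq z w x : z != w -> tau z (Pi w x) = 0.
Proof.
move=> zw; have [_ _ t0] := tauP z; apply: t0 => y zy.
have [_ _ orthHz _] := HzP.
by apply: (orthHz w z) => //; [rewrite eq_sym|exact: (PiP w x).1].
Qed.

Lemma tau_pos z : exists x, 0 < dot (tau z x) x.
Proof.
have [[[_ t0] _] _ _] := tauP z.
apply: contrapT => /forallNP h.
have h0 x : dot (tau z x) x = 0.
  by apply/eqP/negPn/negP => n0; apply: (h x); rewrite lt_neqAle eq_sym n0 t0.
suff : has_trace dot (tau z) 0.
  move=> /(has_trace_unique normH sepH (tau_has_trace z))/eqP.
  by rewrite oner_eq0.
move=> e onb; rewrite (_ : (fun n => _) = cst 0); first exact: cvg_cst.
by apply/funext => n; rewrite big1// => i _; exact: h0.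
Qed.

Variable p : Z -> R[i].

(** On a vector of the block [z] all other terms vanish and the form reduces to
    [p z * dot (tau z x) x]. Since [tau z] has trace 1, some [x] makes the second factor
    positive. *)
Lemma block_weight_ge0 z :
  (forall x, 0 <= dot (\sum_(w <- labels) p w *: tau w (Pi w x)) x) -> 0 <= p z.
Proof.
have [x x0] := tau_pos z; move=> /(_ (Pi z x)).
rewrite (bigD1_seq z) ?fset_uniq ?labels_mem//= big1 => [|w wz]; last first.
  by rewrite tau_Pi tau_Pi_neq ?scaler0.
rewrite addr0 !tau_Pi linearZl_LR/=.
have -> : dot (tau z x) (Pi z x) = dot (tau z x) x.
  rewrite dot_conj [in RHS]dot_conj; congr (_^*)%C.
  have [_ tz _] := tauP z.
  have := dot_projectionl x (tz x).
  by rewrite (linearBl dot)/= => /eqP; rewrite subr_eq0 => /eqP.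
by rewrite pmulr_lge0.
Qed.

Lemma trace_block_label B : has_trace dot
  ((fun x => \sum_(w <- labels) p w *: tau w (Pi w x)) \o block_label Pi B)
  (\sum_(w <- labels) (if w \in B then p w else 0)).
Proof.
have -> : (fun x => \sum_(w <- labels) p w *: tau w (Pi w x)) \o block_label Pi B
    = fun x => \sum_(w <- labels) (if w \in B then p w else 0) *: tau w x.
  apply/funext => x /=; apply: eq_bigr => w _; rewrite tau_Pi block_labelE.
  have [tD _ _ t0] := linear_comb (tau_linear w).
  rewrite (big_morph (tau w) tD t0) (bigD1_seq w) ?fset_uniq ?labels_mem//=.
  rewrite big1 => [|z zw]; last first.
    by case: ifP => _ //; rewrite tau_Pi_neq// eq_sym.
  by rewrite addr0; case: ifP => _; rewrite ?tau_Pi ?t0 ?scaler0 ?scale0r.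
rewrite (eq_bigr (fun w => (if w \in B then p w else 0) * 1)); last first.
  by move=> w _; rewrite mulr1.
by apply: has_trace_sum => w; apply: has_traceZ; exact: tau_has_trace.
Qed.

Lemma trace_block_povm (A : H -> H) (q : Z -> R[i]) :
  (forall z, has_trace dot (tau z \o A) (q z)) -> has_trace dot
  ((fun x => \sum_(w <- labels) p w *: tau w (Pi w x)) \o A)
  (\sum_(w <- labels) p w * q w).
Proof.
move=> hq; have -> : (fun x => \sum_(w <- labels) p w *: tau w (Pi w x)) \o A
    = fun x => \sum_(w <- labels) p w *: (tau w \o A) x.
  by apply/funext => x /=; apply: eq_bigr => w _; rewrite tau_Pi.
by apply: has_trace_sum => w; exact: has_traceZ.
Qed.

End block_diagonal.

End block_decomposition.

(** * The averaged state and the factorization through the label *)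

(** [outcome_law] is a bare set function. Agreeing with a finite sum of weighted Dirac masses on
    every set, it equals that measure as a function, and the integral can be computed there. *)
Lemma integral_weighted_points d (Z : measurableType d) (R : realType)
    (s : seq Z) (p : Z -> R) (mu : set Z -> \bar R) (f : Z -> \bar R) :
  (forall B : set Z, measurable B) -> (forall z, 0 <= p z) ->
  (forall B, mu B = (\sum_(z <- s) (if z \in B then p z else 0))%:E) ->
  (forall z, 0 <= f z)%E ->
  (\int[mu]_x f x = \sum_(z <- s) (p z)%:E * f z)%E.
Proof.
move=> discZ p0 muE f0.
pose m (i : nat) : {measure set Z -> \bar R} :=
  mscale (NngNum (p0 (nth point s i))) (dirac (nth point s i)).
have mf : measurable_fun setT f by move=> _ Y _; exact: discZ.
have -> : mu = msum m (size s).
  apply/funext => B; rewrite muE /msum (big_nth point) big_mkord -sumEFin.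
  apply: eq_bigr => i _.
  rewrite -[RHS]/((p (nth point s i))%:E * dirac (nth point s i) B)%E diracE.
  by case: (_ \in B); rewrite ?mule1 ?mule0.
rewrite ge0_integral_measure_sum// (big_nth point) big_mkord.
apply: eq_bigr => i _.
by rewrite ge0_integral_mscale// integral_dirac// diracT mul1e.
Qed.

Lemma unitary_conj_positive (R : realType) (H : completeNormedModType R[i])
    (dot : {dot H for Num.conj}) (V T : H -> H) :
  unitary dot V -> (forall x, 0 <= dot (T x) x) ->
  forall x, 0 <= dot ((V \o T \o adjoint dot V) x) x.
Proof.
move=> [_ /(congr1 (fun f => f _)) VK _] T0 x; move: VK.
(* If no adjoint existed, the default [cst 0] would be a left inverse of [V], forcing [x = 0]. *)
rewrite /adjoint; case: xgetP => [B -> adjB _|_ /(_ x) /= <-].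
  by rewrite /= adjB.
by rewrite linear0r.
Qed.

Lemma orbit_averaged_state_positive (R : realType)
    (H : completeNormedModType R[i]) (dot : {dot H for Num.conj})
    (G : topologicalGroupType) (haar : probability (borel G) R)
    (U : G -> H -> H) (Theta : Type) (act : G -> Theta -> Theta)
    (rho : Theta -> H -> H) (eta : orbit_space act) :
  hilbert_norm dot -> separable H -> unitary_representation dot U ->
  (forall theta, density_operator dot (rho theta)) ->
  forall x, 0 <= dot (orbit_averaged_state dot U haar act rho eta x) x.
Proof.
move=> normH sepH [UU _ _ _] rho_state x.
(* In the default case the state is 0, whose form is nonnegative as well. *)
rewrite /orbit_averaged_state; case: xgetP => [A -> hA|_]; last by rewrite linear0l.
have [theta etaE] : exists theta, orbit_proj act theta = eta.
  by case: eta {hA} => O [theta E]; exists theta; case: _ / E.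
apply: (bochner_positive normH sepH (hA theta etaE)) => g.
by apply: unitary_conj_positive => //; case: (rho_state theta) => -[].
Qed.

Theorem theorem4p1 (R : realType)
  (H : completeNormedModType R[i]) (dot : {dot H for Num.conj})
  (normH : hilbert_norm dot) (sepH : separable H)
  (G : topologicalGroupType)
  (compactG : compact [set: G]) (hausdorffG : hausdorff_space G)
  (haar : probability (borel G) R) (haarP : is_haar haar)
  (U : G -> H -> H) (UP : unitary_representation dot U)
  (d : measure_display) (Theta : measurableType d)
  (act : G -> Theta -> Theta) (actP : measurable_action act)
  (rho : Theta -> H -> H)
  (rho_state : forall theta, density_operator dot (rho theta))
  (rho_cov : covariant dot U act rho)
  (dZ : measure_display) (Z : measurableType dZ)
  (finZ : finite_set [set: Z]) (discZ : forall B : set Z, measurable B)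
  (Hz : Z -> set H) (HzP : orthogonal_decomposition dot Hz)
  (Pi : Z -> H -> H)
  (PiP : forall z, orthogonal_projection dot (Hz z) (Pi z))
  (Pi_central : forall z, central (invariant_algebra U) (Pi z))
  (tau : Z -> H -> H)
  (tauP : forall z, density_operator_on dot (Hz z) (tau z)) :
  let rhobar := orbit_averaged_state dot U haar act rho in
  let p eta z := trace dot (rhobar eta \o Pi z) in
  (forall eta, rhobar eta =
     fun x => \sum_(z \in [set: Z]) p eta z *: tau z (Pi z x)) ->
  qc_sufficient dot rhobar (@invariant_povm R H dot G U)
    (block_label Pi).
Proof.
move=> rhobar p rhobarE.
have Pi_bounded z : bounded_operator (Pi z) by case: (Pi_central z) => -[].
have rhoE eta : rhobar eta =
    fun x => \sum_(z <- fset_set [set: Z]) p eta z *: tau z (Pi z x).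
  by rewrite rhobarE; apply/funext => x; rewrite (fsbig_finite _ _ finZ).
have p0 eta z : 0 <= p eta z.
  apply: (block_weight_ge0 finZ HzP PiP normH sepH tauP) => x.
  have := orbit_averaged_state_positive haar eta normH sepH UP rho_state x.
  by rewrite -/rhobar rhoE.
split.
  split; first exact: (block_label_povm finZ discZ HzP PiP Pi_bounded).
  move=> g B _; have [UU _ _ _] := UP; have [[lU _] UK _] := UU g.
  have [UD _ _ U0] := linear_comb lU.
  apply/funext => x /=.
  have -> : block_label Pi B (U g x) = U g (block_label Pi B x).
    rewrite !(block_labelE Pi finZ) (big_morph (U g) UD U0).
    apply: eq_bigr => z _; case: ifP => _ //.
    by have [[_ /(_ g)/(congr1 (fun f => f x))]] := Pi_central z.
  exact: (congr1 (fun f => f _) UK).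
move=> d' Y N [NP _].
(* The kernel is fixed before [eta] is introduced, which is possible because [tau z] does not depend
   on [eta]. *)
have [K KP] : exists K : Z -> probability Y R, forall z B, measurable B ->
    has_trace dot (tau z \o N B) (fine (K z B))%:C.
  have ex z : exists Q : probability Y R, forall B, measurable B ->
      has_trace dot (tau z \o N B) (fine (Q B))%:C.
    by apply: povm_law_trace normH sepH NP _; case: (tauP z).
  by exists (fun z => projT1 (cid (ex z))) => z; exact: projT2 (cid (ex z)).
have mK : measurable_fun [set: Z] (K : Z -> pprobability Y R).
  by move=> _ ? _; exact: discZ.
exists (kprobability mK) => eta B mB.
have lawE (C : set Z) : outcome_law dot (rhobar eta) (block_label Pi) C =
    (\sum_(z <- fset_set [set: Z]) (if z \in C then Re (p eta z) else 0))%:E.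
  rewrite /outcome_law rhoE.
  have := trace_block_label finZ HzP PiP tauP (p := p eta) (B := C).
  move=> /(has_traceE normH sepH) ->.
  by rewrite Re_sum; congr _%:E; apply: eq_bigr => z _; case: ifP.
rewrite (integral_weighted_points discZ _ lawE) => [|z|z]; last 2 first.
- by have := p0 eta z; rewrite lecE => /andP[].
- exact: measure_ge0.
rewrite /outcome_law rhoE.
have hq z : has_trace dot (tau z \o N B) (fine (K z B))%:C by exact: KP.
rewrite (has_traceE normH sepH (trace_block_povm PiP tauP (p := p eta) hq)).
rewrite Re_sum -sumEFin; apply: eq_bigr => z _.
rewrite -[X in (_ * X)%E]/(K z B) -[in RHS](fineK (fin_num_measure (K z) B mB)).
rewrite -EFinM.
by congr _%:E; case: (p eta z) => a b /=; rewrite mulr0 subr0.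
Qed.
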